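(* Let $1<p\le t\le r\le\infty$. Let $\omega$ and $\omega':=\omega^{-1/(p-1)}$ be weights. Then a measurable function $f$ on $X$ belongs to $\mathcal H_{p',\omega'}^{t',r'}$ if and only if there exists $g\in\mathcal H_{p',\omega'}^{t',r'}$ such that $|f(x)|\le g(x)$ for $\mu$-a.e. $x\in X$.
   Context: Setting: $(X,\rho,\mu)$ is a space of homogeneous type with quasidistance $\rho$ and nonnegative Borel measure $\mu$, $\mu(X)=\infty$. $B(x,r)=\{y:\rho(x,y)<r\}$, $V(x,r)=\mu(B(x,r))$. Doubling: $V(x,2r)\le CV(x,r)$ for all $x\in X$, $r>0$. Dyadic cubes: fix a Christ dyadic system $\mathcal D=\{Q_\tau^k:k\in\mathbb Z,\tau\in I_k\}$ of open subsets of $X$ such that: $\mu(X\setminus\bigcup_{\tau\in I_k}Q_\tau^k)=0$ for all $k$; if $i\ge k$ then either $Q_\tau^i\subset Q_\beta^k$ or $Q_\tau^i\cap Q_\beta^k=\emptyset$; for each $(k,\tau)$ and $i<k$ there is a unique $\tau'$ with $Q_\tau^k\subset Q_{\tau'}^i$; $\operatorname{diam}Q_\tau^k\le\kappa_0\gamma^k$; each $Q_\tau^k$ contains a ball $B(x_{Q_\tau^k},a_0\gamma^k)$. Here $\kappa_0\in(0,\infty)$ and $\gamma=a_0=1/2$ (normalized). The parent of $Q_\tau^k$ is the cube $Q_{\tau'}^{k-1}$ containing it. Reverse doubling: there is $\alpha_0\in(0,1)$ with $\mu(Q)\le\alpha_0\mu(R)$ whenever $Q$ is a dyadic cube and $R$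 is its parent. Weights: a weight is a locally integrable function on $X$ with values in $(0,\infty)$ a.e.; $\omega(E)=\int_E\omega\,d\mu$. Primes on exponents denote conjugates ($1/p+1/p'=1$), while $\omega'=\omega^{-1/(p-1)}$ (with $1/(p-1)=0$ if $p=\infty$). Block space: a function $b$ is a $(p',t',\omega')$-block supported in a dyadic cube $Q$ if $\operatorname{supp}b\subset Q$ and $\big(\int_Q|b(x)|^{p'}\omega(x)^{-1/(p-1)}d\mu(x)\big)^{1/p'}\le\omega(Q)^{1/t-1/p}$. The space $\mathcal H_{p',\omega'}^{t',r'}$ is the set of all measurable $f$ on $X$ that can be written $f=\sum_{k\in\mathbb Z}\sum_{\tau\in I_k}\lambda_{k,\tau}b_{k,\tau}$ $\mu$-a.e., with $\{\lambda_{k,\tau}\}\in\ell^{r'}$ and each $b_{k,\tau}$ a $(p',t',\omega')$-block supported in $Q_\tau^k$; its norm is the infimum of $\|\{\lambda_{k,\tau}\}\|_{\ell^{r'}}$ over all such decompositions. *)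

(* Defs.v *)
From HB Require Import structures.
From mathcomp Require Import all_boot all_order all_algebra.
From mathcomp Require Import complex.
From mathcomp Require Import all_classical all_reals all_analysis.

Set Implicit Arguments.
Unset Strict Implicit.
Unset Printing Implicit Defensive.

Import Order.TTheory GRing.Theory Num.Theory.
Import numFieldNormedType.Exports.

Local Open Scope classical_set_scope.
Local Open Scope ring_scope.

Definition qball (R : realType) (X : Type) (rho : X -> X -> R) (x : X) (r : R)
  : set X := [set y | rho x y < r].

(* Balls of a quasidistance need not be open for this topology. *)
Definition qopen (R : realType) (X : Type) (rho : X -> X -> R) (U : set X) :=
  forall x, U x -> exists2 r, 0 < r & qball rho x r `<=` U.

Record is_quasidistance (R : realType) (X : Type) (rho : X -> X -> R) : Prop := {
  qdist_ge0 : forall x y, 0 <= rho x y ;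
  qdist_eq0 : forall x y, rho x y = 0 <-> x = y ;
  qdist_sym : forall x y, rho x y = rho y x ;
  qdist_triangle : exists A : R,
    forall x y z, rho x y <= A * (rho x z + rho z y) }.

(* Space of homogeneous type in the sense of Coifman and Weiss: balls are
   measurable, and the doubling measure is positive and finite on balls. *)
Record homogeneous_type (R : realType) (d : measure_display)
    (X : measurableType d) (rho : X -> X -> R)
    (mu : {measure set X -> \bar R}) : Prop := {
  ht_quasidistance : is_quasidistance rho ;
  ht_borel : (@measurable d X) = <<s qopen rho >> ;
  ht_measurable_ball : forall x r, measurable (qball rho x r) ;
  ht_ball_fin : forall x r, 0 < r ->
    (0 < mu (qball rho x r))%E /\ (mu (qball rho x r) < +oo)%E ;
  ht_doubling : exists C : R, forall x r, 0 < r ->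
    (mu (qball rho x (2 * r)) <= C%:E * mu (qball rho x r))%E }.

(* [Q k tau] is the cube of generation [k] and index [tau], and both constants
   gamma and a_0 of the system are 1/2. *)
Record dyadic_system (R : realType) (d : measure_display)
    (X : measurableType d) (rho : X -> X -> R)
    (mu : {measure set X -> \bar R}) (kappa0 : R)
    (I : int -> choiceType) (Q : forall k, I k -> set X) : Prop := {
  ds_kappa0_gt0 : 0 < kappa0 ;
  ds_open : forall k tau, qopen rho (Q k tau) ;
  ds_cover : forall k, mu (~` \bigcup_(tau in [set: I k]) Q k tau) = 0%E ;
  ds_nested : forall i k (tau : I i) (beta : I k), k <= i ->
    Q i tau `<=` Q k beta \/ Q i tau `&` Q k beta = set0 ;
  ds_ancestor : forall i k (tau : I k), i < k ->
    exists! tau' : I i, Q k tau `<=` Q i tau' ;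
  ds_diam : forall k tau x y, Q k tau x -> Q k tau y ->
    rho x y <= kappa0 * 2^-1 ^ k ;
  ds_inner_ball : forall k tau, exists x,
    qball rho x (2^-1 * 2^-1 ^ k) `<=` Q k tau }.

Definition reverse_doubling (R : realType) (d : measure_display)
    (X : measurableType d) (mu : {measure set X -> \bar R})
    (I : int -> choiceType) (Q : forall k, I k -> set X) : Prop :=
  exists2 alpha0 : R, 0 < alpha0 < 1 &
    forall k (tau : I k) (tau' : I (k - 1)), Q k tau `<=` Q (k - 1)%R tau' ->
      (mu (Q k tau) <= alpha0%:E * mu (Q (k - 1)%R tau'))%E.

(* Local integrability is integrability on every ball. *)
Definition is_weight (R : realType) (d : measure_display)
    (X : measurableType d) (rho : X -> X -> R)
    (mu : {measure set X -> \bar R}) (w : X -> R) : Prop :=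
  [/\ measurable_fun setT w,
      {ae mu, forall x, 0 < w x} &
      forall x r, 0 < r -> mu.-integrable (qball rho x r) (EFin \o w)].

Definition weight_mass (R : realType) (d : measure_display)
    (X : measurableType d) (mu : {measure set X -> \bar R}) (w : X -> R)
    (E : set X) : \bar R := (\int[mu]_(x in E) (w x)%:E)%E.

(* omega' = omega^(-1/(p-1)); since +oo^-1 = 0, it is omega^0 = 1 if p = +oo. *)
Definition dual_weight (R : realType) (X : Type) (p : \bar R) (w : X -> R)
  : X -> R := fun x => w x `^ (- fine ((p - 1)^-1)%E).

Definition conj_exp (R : realType) (p : \bar R) : R :=
  fine (hoelder_conjugate p).

Definition cmeasurable (R : realType) (d : measure_display)
    (X : measurableType d) (f : X -> R[i]) : Prop :=
  measurable_fun setT (fun x => complex.Re (f x)) /\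
  measurable_fun setT (fun x => complex.Im (f x)).

(* The norm of R[i] takes real values in R[i]; this is the same norm in R. *)
Definition cabs (R : realType) (z : R[i]) : R := complex.Re `|z|.

Definition is_block (R : realType) (d : measure_display)
    (X : measurableType d) (mu : {measure set X -> \bar R}) (p t : \bar R)
    (w : X -> R) (Q : set X) (b : X -> R[i]) : Prop :=
  [/\ cmeasurable b,
      forall x, ~ Q x -> b x = 0 &
      ((\int[mu]_(x in Q)
          (cabs (b x) `^ conj_exp p * dual_weight p w x)%:E)
         `^ (conj_exp p)^-1
       <= weight_mass mu w Q `^ fine (t^-1 - p^-1))%E].

Definition in_lq (R : realType) (J : choiceType) (q : R) (l : J -> R[i]) :=
  (\esum_(j in [set: J]) (cabs (l j) `^ q)%:E < +oo)%E.

(* Convergence of a two-sided series: both one-sided series converge. *)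
Definition zsum_to (R : realType) (u : int -> R[i]) (s : R[i]) : Prop :=
  exists s1 s2 : R[i]^o, [/\
    (series (fun n : nat => u n%:Z : R[i]^o)) @ \oo --> s1,
    (series (fun n : nat => u (- n.+1%:Z) : R[i]^o)) @ \oo --> s2 &
    s = s1 + s2].

(* [block_space mu Q p t r w] is H_{p',w'}^{t',r'}.  The inner sum at a point is
   a finite-support sum: two cubes of the same generation with distinct indices
   are disjoint, so at most one block of each generation is nonzero there. *)
Definition block_space (R : realType) (d : measure_display)
    (X : measurableType d) (mu : {measure set X -> \bar R})
    (I : int -> choiceType) (Q : forall k, I k -> set X)
    (p t r : \bar R) (w : X -> R) (f : X -> R[i]) : Prop :=
  cmeasurable f /\
  exists (l : forall k, I k -> R[i]) (b : forall k, I k -> X -> R[i]), [/\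
    in_lq (conj_exp r) (fun j : {k : int & I k} => l (tag j) (tagged j)),
    forall k tau, is_block mu p t w (Q k tau) (b k tau) &
    {ae mu, forall x,
      zsum_to (fun k => \sum_(tau \in [set: I k]) l k tau * b k tau x) (f x)}].

(* Main.v *)
(* Absolute convergence of [\sum_Q l_Q b_Q] can fail, so [\sum_Q |l_Q| |b_Q|] is
   not available as a majorant of [f]. Instead, write [u_k] for the sum of
   the generation-[k] terms and [S_n] for the sum of the [u_k], [-n <= k < n].
   As [S_n] tends to [f] a.e., for a.e. [x] there is a least [n(x)] with
   [|f(x)| <= 2 |S_n(x)|], and [|f|] is the finite sum of the [m_k u_k], where
   [m_k = |f| / S_n(x)] for [-n(x) <= k < n(x)] and [m_k = 0] otherwise. Since
   [|m_k| <= 2], the functions [m_k b_Q / 2] are again blocks, so [|f|] itself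
   lies in the space. Conversely, if [|f| <= g], multiply all blocks of [g] by
   [f / g]. *)
Require Import Defs.
From HB Require Import structures.
From mathcomp Require Import all_boot all_order all_algebra.
From mathcomp Require Import complex finmap.
From mathcomp Require Import all_classical all_reals all_analysis measurable_realfun.

Set Implicit Arguments.
Unset Strict Implicit.
Unset Printing Implicit Defensive.

Import Order.TTheory GRing.Theory Num.Theory.
Import numFieldNormedType.Exports.

Local Open Scope classical_set_scope.
Local Open Scope ring_scope.

(** * Measurability of complex-valued functions *)

Lemma measurable_fun_cover (d d' : measure_display) (X : measurableType d)
  (Y : measurableType d') (E : nat -> set X) (F : nat -> X -> Y) (f : X -> Y) :
  (forall n, measurable (E n)) -> (forall n, measurable_fun setT (F n)) ->
  (forall x, exists n, E n x) -> (forall n x, E n x -> f x = F n x) ->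
  measurable_fun setT f.
Proof.
move=> mE mF cE fF.
have <- : \bigcup_n E n = setT.
  by apply/seteqP; split=> // x _; have [n En] := cE x; exists n.
apply/measurable_fun_bigcup => // n.
apply: (eq_measurable_fun (F n)); last exact: measurable_funTS.
by move=> x /[!inE] /fF.
Qed.

Section complex_measurability.
Variables (R : realType) (d : measure_display) (X : measurableType d).
Implicit Types (f g : X -> R[i]).

Lemma cabsE (z : R[i]) : `|z| = (cabs z)%:C%C.
Proof. by rewrite /cabs normc_def. Qed.

Lemma cabs_ge0 (z : R[i]) : 0 <= cabs z.
Proof. by rewrite -ler0c -cabsE. Qed.

Lemma cabsM (y z : R[i]) : cabs (y * z) = cabs y * cabs z.
Proof. by apply: complexI; rewrite rmorphM -!cabsE normrM. Qed.

Lemma cabs_eq0 (z : R[i]) : (cabs z == 0) = (z == 0).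
Proof. by rewrite -(inj_eq (@complexI R)) -cabsE normr_eq0. Qed.

Lemma ler_cabs (y z : R[i]) : (cabs y <= cabs z) = (`|y| <= `|z|).
Proof. by rewrite !cabsE lecR. Qed.

(** Inversion is discontinuous at [0], so it is read as the power [-1], which agrees with it on
    nonnegative reals, including [0^-1 = 0]. *)
Lemma measurable_fun_inv_ge0 (h : X -> R) : (forall x, 0 <= h x) ->
  measurable_fun setT h -> measurable_fun setT (fun x => (h x)^-1).
Proof.
move=> h0 mh; rewrite [X in measurable_fun _ X](_ : _ = fun x => h x `^ (-1)).
  exact: measurableT_comp (measurable_powR _) mh.
by apply/funext => x; rewrite powR_inv1.
Qed.

Lemma measurable_cabs f : cmeasurable f -> measurable_fun setT (fun x => cabs (f x)).
Proof.
move=> [mr mi].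
rewrite [X in measurable_fun _ X](_ : _ = fun x =>
  (complex.Re (f x) ^+ 2 + complex.Im (f x) ^+ 2) `^ 2^-1).
  apply: measurableT_comp (measurable_powR _) _.
  by apply: measurable_funD; exact: measurable_funX.
by apply/funext => x; rewrite powR12_sqrt ?addr_ge0 ?sqr_ge0// /= /cabs normc_def.
Qed.

Lemma cmeasurable_cst (z : R[i]) : cmeasurable (fun _ : X => z).
Proof. by split; exact: measurable_cst. Qed.

Lemma cmeasurable_real (h : X -> R) :
  measurable_fun setT h -> cmeasurable (fun x => (h x)%:C%C).
Proof. by move=> mh; split => //=; exact: measurable_cst. Qed.

Lemma cmeasurable_norm f : cmeasurable f -> cmeasurable (fun x => `|f x|).
Proof.
move=> /measurable_cabs /cmeasurable_real.
by congr cmeasurable; apply/funext => x; rewrite cabsE.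
Qed.

Lemma cmeasurableD f g :
  cmeasurable f -> cmeasurable g -> cmeasurable (fun x => f x + g x).
Proof.
move=> [fr fi] [gr gi]; split.
  rewrite [X in measurable_fun _ X](_ : _ = fun x =>
    complex.Re (f x) + complex.Re (g x)); first exact: measurable_funD.
  by apply/funext => x; case: (f x) (g x) => [? ?] [? ?].
rewrite [X in measurable_fun _ X](_ : _ = fun x =>
  complex.Im (f x) + complex.Im (g x)); first exact: measurable_funD.
by apply/funext => x; case: (f x) (g x) => [? ?] [? ?].
Qed.

Lemma cmeasurableM f g :
  cmeasurable f -> cmeasurable g -> cmeasurable (fun x => f x * g x).
Proof.
move=> [fr fi] [gr gi]; split.
  rewrite [X in measurable_fun _ X](_ : _ = fun x =>
    complex.Re (f x) * complex.Re (g x) - complex.Im (f x) * complex.Im (g x)).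
    by apply: measurable_funB; exact: measurable_funM.
  by apply/funext => x; case: (f x) (g x) => [? ?] [? ?].
rewrite [X in measurable_fun _ X](_ : _ = fun x =>
  complex.Re (f x) * complex.Im (g x) + complex.Im (f x) * complex.Re (g x)).
  by apply: measurable_funD; exact: measurable_funM.
by apply/funext => x; case: (f x) (g x) => [? ?] [? ?].
Qed.

(** The inverse of [z] is its conjugate over [|z|^2], also at [z = 0], where both are [0]. *)
Lemma cmeasurableV f : cmeasurable f -> cmeasurable (fun x => (f x)^-1).
Proof.
move=> [fr fi].
have mn : measurable_fun setT
    (fun x => (complex.Re (f x) ^+ 2 + complex.Im (f x) ^+ 2)^-1).
  apply: measurable_fun_inv_ge0 => [x|]; first by rewrite addr_ge0 ?sqr_ge0.
  by apply: measurable_funD; exact: measurable_funX.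
split.
  rewrite [X in measurable_fun _ X](_ : _ = fun x => complex.Re (f x) *
    (complex.Re (f x) ^+ 2 + complex.Im (f x) ^+ 2)^-1).
    exact: measurable_funM.
  by apply/funext => x; case: (f x) => [? ?].
rewrite [X in measurable_fun _ X](_ : _ = fun x => - (complex.Im (f x) *
  (complex.Re (f x) ^+ 2 + complex.Im (f x) ^+ 2)^-1)).
  by apply: measurable_funN; exact: measurable_funM.
by apply/funext => x; case: (f x) => [? ?].
Qed.

Lemma cmeasurable_sum (I : Type) (s : seq I) (h : I -> X -> R[i]) :
  (forall i, cmeasurable (h i)) -> cmeasurable (fun x => \sum_(i <- s) h i x).
Proof.
move=> mh; elim: s => [|i s IHs].
  under [X in cmeasurable X]eq_fun do rewrite big_nil.
  exact: cmeasurable_cst.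
under [X in cmeasurable X]eq_fun do rewrite big_cons.
exact: cmeasurableD.
Qed.

Lemma cmeasurable_cover (E : nat -> set X) (F : nat -> X -> R[i]) f :
  (forall n, measurable (E n)) -> (forall n, cmeasurable (F n)) ->
  (forall x, exists n, E n x) -> (forall n x, E n x -> f x = F n x) ->
  cmeasurable f.
Proof.
move=> mE mF cE fF; split; apply: (measurable_fun_cover mE _ cE).
- by move=> n; exact: (mF n).1.
- by move=> n x /fF ->.
- by move=> n; exact: (mF n).2.
- by move=> n x /fF ->.
Qed.

Lemma cmeasurable_if (c : X -> bool) f g : measurable_fun setT c ->
  cmeasurable f -> cmeasurable g -> cmeasurable (fun x => if c x then f x else g x).
Proof.
move=> mc mf mg.
(* Index [0] is the set where [c] holds; every positive index gives its complement. *)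
apply: (@cmeasurable_cover (fun n => [set x | c x = (n == 0%N)])
  (fun n => if n == 0%N then f else g)).
- move=> n; rewrite -[X in measurable X]setTI.
  exact: (mc measurableT [set (n == 0%N)]).
- by move=> n; case: ifP.
- by move=> x; case cx: (c x); [exists 0%N|exists 1%N].
- by move=> n x ->; case: ifP.
Qed.

(** On [E j] the sum reduces to [h j], and it vanishes off the sets [E j] with [j] in [D].
    Countability of [D] turns this into a countable cover even if [J] is uncountable. *)
Lemma cmeasurable_fsbig_disjoint (J : choiceType) (E : J -> set X)
  (h : J -> X -> R[i]) (D : set J) :
  countable D -> (forall j, measurable (E j)) ->
  (forall i j, i <> j -> E i `&` E j = set0) ->
  (forall j, cmeasurable (h j)) -> (forall j x, ~ E j x -> h j x = 0) ->
  (forall j x, ~ D j -> h j x = 0) ->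
  cmeasurable (fun x => \sum_(j \in [set: J]) h j x).
Proof.
move=> cD mE dE mh hE hD.
have one j x : E j x -> \sum_(i \in [set: J]) h i x = h j x.
  move=> Ejx; rewrite -(@fsbig_widen _ _ _ _ [set j] setT) ?fsbig_set1//.
  move=> i [_ /= ij]; apply: hE => Eix.
  by have : (E i `&` E j) x by []; rewrite dE.
have [D0|[e]] := pfcard_geP cD; last have De : D `<=` range e by exact: surj.
- rewrite [X in cmeasurable X](_ : _ = fun=> 0); first exact: cmeasurable_cst.
  by apply/funext => x; rewrite fsbig1// => j _; apply: hD; rewrite D0.
(* Piece [0] is where all terms vanish; the enumeration [e] of [D] is shifted by one to make room
   for it. *)
apply: (@cmeasurable_cover
  (fun n => if n is m.+1 then E (e m) else ~` \bigcup_m E (e m))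
  (fun n => if n is m.+1 then h (e m) else fun=> 0)).
- case=> [|n]; last exact: mE.
  by apply: measurableC; apply: bigcup_measurable => n _; exact: mE.
- by case=> [|n]; [exact: cmeasurable_cst|exact: mh].
- move=> x; have [[n _ Enx]|nE] := pselect ((\bigcup_m E (e m)) x).
    by exists n.+1.
  by exists 0%N.
- case=> [x nE|n x Ex]; last exact: one.
  rewrite fsbig1// => j _; have [/De[n _ nj]|/hD//] := pselect (D j).
  by apply: hE => Ejx; apply: nE; exists n => //; rewrite nj.
Qed.

End complex_measurability.

(** * Summable nonnegative families *)

Section nonnegative_family.
Variables (R : realType) (J : choiceType) (a : J -> R).
Hypothesis a0 : forall j, 0 <= a j.

(** If the total is [S], fewer than about [(n+1) S] values can exceed [1/(n+1)]; the support is the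
    union over [n] of these finite sets. *)
Lemma countable_esum_support :
  (\esum_(j in [set: J]) (a j)%:E < +oo)%E -> countable [set j | a j != 0].
Proof.
move=> fin.
have finl n : finite_set [set j | n.+1%:R^-1 < a j].
  apply: contrapT => inf.
  have Sfin : (\esum_(j in [set: J]) (a j)%:E)%E \is a fin_num.
    by rewrite ge0_fin_numE// esum_ge0// => j _; rewrite lee_fin.
  set S := fine (\esum_(j in [set: J]) (a j)%:E)%E.
  have [B BA NB] := infinite_set_fset (Num.truncn (n.+1%:R * S)).+1 inf.
  have BS : \sum_(j <- B) a j <= S.
    rewrite -lee_fin fineK//; apply: esum_ge; exists [set` B] => //.
    by rewrite fsbig_finite//= set_fsetK sumEFin.
  have : (#|` B|)%fset%:R <= n.+1%:R * S.
    rewrite -ler_pdivrMl ?ltr0n//; apply: le_trans BS.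
    rewrite mulr_natr; apply: (@le_trans _ _ (\sum_(j <- B) n.+1%:R^-1)).
      by rewrite big_const_seq iter_addr_0 count_predT.
    by rewrite big_seq [leRHS]big_seq; apply: ler_sum => j /BA /ltW.
  apply/negP; rewrite -ltNge; apply: lt_le_trans (truncnS_gt _) _.
  by rewrite ler_nat.
apply: (@sub_countable _ _ _ (\bigcup_n [set j | n.+1%:R^-1 < a j])).
  apply: subset_card_le => j /= aj0; have aj : 0 < a j by rewrite lt_neqAle eq_sym aj0 a0.
  by exists (Num.truncn (a j)^-1); rewrite //= invf_plt ?posrE// truncnS_gt.
by apply: bigcup_countable => // n _; exact: finite_set_countable.
Qed.

Lemma esumZ_lty (c : R) : 0 <= c ->
  (\esum_(j in [set: J]) (a j)%:E < +oo)%E ->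
  (\esum_(j in [set: J]) (c * a j)%:E < +oo)%E.
Proof.
move=> c0 fin; apply: (@le_lt_trans _ _ (c%:E * \esum_(j in [set: J]) (a j)%:E)%E).
  apply: ge_ereal_sup => _ [A [finA _] <-].
  under eq_fsbigr do rewrite EFinM.
  rewrite -ge0_mule_fsumr; last by move=> j; rewrite lee_fin.
  by rewrite lee_wpmul2l ?lee_fin//; apply: esum_ge; exists A.
rewrite lte_mul_pinfty// lee_fin//.
Qed.

End nonnegative_family.

(** * Measurability and disjointness of dyadic cubes *)

Section homogeneous_dyadic.
Variables (R : realType) (d : measure_display) (X : measurableType d).
Variables (rho : X -> X -> R) (mu : {measure set X -> \bar R}).
Hypothesis hX : homogeneous_type rho mu.
Variables (kappa0 : R) (I : int -> choiceType) (Q : forall k : int, I k -> set X).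
Hypothesis hQ : dyadic_system rho mu kappa0 Q.

Lemma qopen_measurable (U : set X) : qopen rho U -> measurable U.
Proof. by move=> oU; rewrite (ht_borel hX); exact: sub_sigma_algebra. Qed.

Lemma dyadic_cube_measurable k (tau : I k) : measurable (Q tau).
Proof. by apply: qopen_measurable; exact: (ds_open hQ). Qed.

(* Distinct indices cannot label the same set: such a cube would contain a cube
   of the next generation, whose parent index is unique. *)
Lemma dyadic_cube_disjoint k (tau beta : I k) :
  tau <> beta -> Q tau `&` Q beta = set0.
Proof.
move=> tb; have [tauS|//] := ds_nested hQ tau beta (lexx k).
exfalso; apply: tb.
have [x xball] := ds_inner_ball hQ tau.
set r := 2^-1 * 2^-1 ^ k in xball.
have r0 : 0 < r by rewrite mulr_gt0// ?invr_gt0// exprz_gt0 ?invr_gt0.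
(* The ball inside [Q tau] has positive measure, whereas the cubes of generation [k + 1] miss only a
   null set, so one of them meets [Q tau]. *)
have [s sQ] : exists s : I (k + 1), Q s `&` Q tau !=set0.
  apply: contrapT => noS.
  have mball := ht_measurable_ball hX x r.
  have [+ _] := ht_ball_fin hX x r0; apply/negP; rewrite -leNgt.
  rewrite -(ds_cover hQ (k + 1)); apply: le_measure; rewrite ?inE//.
    apply/measurableC/qopen_measurable => y [s _ sy].
    have [e e0 eS] := ds_open hQ sy.
    by exists e => //; apply: subset_trans eS _ => z zs; exists s.
  move=> y /xball ty [s _ sy]; apply: noS; exists s; exists y; split => //.
have kk1 : k < k + 1 by rewrite ltrDl.
have [sS|s0] := ds_nested hQ s tau (ltW kk1); last first.
  by move: sQ; rewrite s0 => -[].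
have [u [_ uniq]] := ds_ancestor hQ s kk1.
by rewrite -(uniq tau)// -(uniq beta)//; exact: subset_trans tauS.
Qed.

End homogeneous_dyadic.

(** * Stability of blocks under domination *)

Lemma conj_exp_gt0 (R : realType) (p : \bar R) : (1 < p)%E -> 0 < conj_exp p.
Proof.
rewrite /conj_exp /hoelder_conjugate; case: p => [p| |]//=.
rewrite lte_fin => p1; rewrite eqe gt_eqF ?(lt_trans _ p1)//.
have p10 : 0 < p - 1 by rewrite subr_gt0.
by rewrite -EFinB inver gt_eqF//= divr_gt0// (lt_trans _ p1).
Qed.

(** The support condition passes to [c] because [b x = 0] forces [c x = 0]; the size condition
    passes by monotonicity of both powers and of the integral. *)
Lemma is_block_le (R : realType) (d : measure_display) (X : measurableType d)
  (mu : {measure set X -> \bar R}) (p t : \bar R) (w : X -> R) (E : set X)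
  (b c : X -> R[i]) : (1 < p)%E -> measurable E ->
  measurable_fun setT (dual_weight p w) -> cmeasurable c ->
  (forall x, cabs (c x) <= cabs (b x)) ->
  is_block mu p t w E b -> is_block mu p t w E c.
Proof.
move=> p1 mE mw mc cb [mb bE bt]; have q0 := conj_exp_gt0 p1.
split; [exact: mc| |].
  by move=> x /bE bx0; apply/eqP; rewrite -cabs_eq0 eq_le cabs_ge0 andbT
    (le_trans (cb x))// bx0 /cabs normr0.
have mint f : cmeasurable f -> measurable_fun E
    (fun x => (cabs (f x) `^ conj_exp p * dual_weight p w x)%:E).
  move=> mf; apply: measurable_funTS; apply/measurable_EFinP.
  apply: measurable_funM => //.
  exact: measurableT_comp (measurable_powR _) (measurable_cabs mf).
have i0 f x : (0 <= (cabs (f x) `^ conj_exp p * dual_weight p w x)%:E)%E.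
  by rewrite lee_fin mulr_ge0// powR_ge0.
apply: le_trans bt; apply: gt0_ler_poweR.
- by rewrite invr_ge0 ltW.
- by rewrite in_itv/= leey andbT integral_ge0.
- by rewrite in_itv/= leey andbT integral_ge0.
apply: ge0_le_integral => //; [exact: mint|exact: mint|move=> x _].
rewrite lee_fin ler_wpM2r ?powR_ge0// ge0_ler_powR ?nnegrE ?cabs_ge0//.
exact: ltW.
Qed.

(** * One-sided and two-sided series *)

Section numfield_series.
Variable K : numFieldType.
Implicit Types (v : nat -> K^o) (c s : K).

Lemma cvg_series_mull c v s : series v @ \oo --> (s : K^o) ->
  series (fun n => c * v n : K^o) @ \oo --> (c * s : K^o).
Proof.
move=> vs; rewrite (_ : series _ = c \*: series v); last first.
  by apply/funext => n; rewrite /series/= scaler_sumr.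
exact: cvgZl_tmp.
Qed.

Lemma cvg_series_truncated c v n :
  series (fun i => (if (i < n)%N then c else 0) * v i : K^o) @ \oo -->
  (c * \sum_(0 <= i < n) v i : K^o).
Proof.
apply: (cvg_near_cst (U := K^o)).
near=> N; have nN : (n <= N)%N by near: N; exact: nbhs_infty_ge.
rewrite /series/= (big_cat_nat (leq0n n) nN)/=.
rewrite [X in _ + X]big_nat_cond [X in _ + X]big1 ?addr0; last first.
  by move=> i /andP[/andP[ni _] _]; rewrite ltnNge ni mul0r.
rewrite mulr_sumr big_nat_cond [RHS]big_nat_cond.
by apply: eq_bigr => i /andP[/andP[_ ->]].
Unshelve. all: by end_near. Qed.

(** If [s] is nonzero, some [S n] is within [|s| / 2] of it, hence [|S n| >= |s| / 2]. A factor
    above [1] is needed, since [S n] may approach [s] with smaller norm. *)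
Lemma cvg_norm_le2 (S : nat -> K^o) s :
  S @ \oo --> (s : K^o) -> exists n, `|s| <= 2 * `|S n|.
Proof.
have [->|s0] := eqVneq s 0; first by exists 0%N; rewrite normr0 mulr_ge0.
move=> /cvgrPdist_lt /(_ (`|s| / 2)).
rewrite divr_gt0 ?normr_gt0// => /(_ isT)[n _ /(_ n (leqnn n)) nS].
exists n; have := ler_normD (s - S n) (S n); rewrite subrK => /le_trans.
move=> /(_ (`|s| / 2 + `|S n|)); rewrite lerD2r ltW// => /(_ isT).
by rewrite [X in X <= _ -> _](splitr `|s|) lerD2l ler_pdivrMr// mulrC.
Qed.

End numfield_series.

(** No case [z = 0] has to be excluded: the quotient is then [0], and [0 <= c] suffices. *)
Lemma cabs_div_le (R : realType) (c : R) (y z : R[i]) : 0 <= c ->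
  cabs y <= c * cabs z -> cabs (y / z) <= c.
Proof.
move=> c0 yz; have [->|z0] := eqVneq z 0.
  by rewrite invr0 mulr0 /cabs normr0.
have zgt0 : 0 < cabs z by rewrite lt_neqAle eq_sym cabs_eq0 z0 cabs_ge0.
by rewrite -(ler_pM2r zgt0) -cabsM divfK.
Qed.

(** As [Negz i] is [-(i + 1)], this is the window [-n <= k < n], with [n] indices on each side as in
    [zpartial]. *)
Definition zwindow (n : nat) (k : int) : bool :=
  match k with Posz i => (i < n)%N | Negz i => (i < n)%N end.

Section two_sided_series.
Variables (K : numFieldType).
Implicit Types (u : int -> K) (c s : K).

(* [zsum_to] is, by conversion, the instance [K = R[i]]. *)
Definition zsum u s : Prop :=
  exists s1 s2 : K^o, [/\
    series (fun n : nat => u n%:Z : K^o) @ \oo --> s1,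
    series (fun n : nat => u (- n.+1%:Z) : K^o) @ \oo --> s2 &
    s = s1 + s2].

Definition zpartial u (n : nat) : K :=
  \sum_(0 <= i < n) u i%:Z + \sum_(0 <= i < n) u (- i.+1%:Z).

Lemma zsumZ c u s : zsum u s -> zsum (fun k => c * u k) (c * s).
Proof.
move=> [s1 [s2 [us1 us2 ->]]]; exists (c * s1), (c * s2).
by split; [exact: cvg_series_mull|exact: cvg_series_mull|rewrite mulrDr].
Qed.

(** Both one-sided series are eventually constant. With [c = |f| / S_n] this recovers [|f|] from
    finitely many generations. *)
Lemma zsum_window c u n :
  zsum (fun k => (if zwindow n k then c else 0) * u k) (c * zpartial u n).
Proof.
exists (c * \sum_(0 <= i < n) u i%:Z), (c * \sum_(0 <= i < n) u (- i.+1%:Z)).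
split; last by rewrite mulrDr.
- exact: (@cvg_series_truncated K c (fun i => u i%:Z) n).
- exact: (@cvg_series_truncated K c (fun i => u (- i.+1%:Z)) n).
Qed.

(** Adding the two one-sided limits shows that the symmetric partial sums converge to [s]. *)
Lemma zsum_norm_le2 u s : zsum u s -> exists n, `|s| <= 2 * `|zpartial u n|.
Proof.
move=> [s1 [s2 [us1 us2 ->]]].
have [|n] := @cvg_norm_le2 K (zpartial u) (s1 + s2); last by exists n.
exact: cvgD us1 us2.
Qed.

End two_sided_series.

(** * Generation sums and multipliers on the block space *)

Section block_space.
Variables (R : realType) (d : measure_display) (X : measurableType d).
Variables (rho : X -> X -> R) (mu : {measure set X -> \bar R}).
Hypothesis hX : homogeneous_type rho mu.
Variables (kappa0 : R) (I : int -> choiceType) (Q : forall k : int, I k -> set X).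
Hypothesis hQ : dyadic_system rho mu kappa0 Q.
Variables (p t r : \bar R).
Hypothesis hp : (1 < p)%E.
Variable w : X -> R.
Hypothesis hw : measurable_fun setT (dual_weight p w).
Variables (l : forall k, I k -> R[i]) (b : forall k, I k -> X -> R[i]).
Hypothesis hl : in_lq (conj_exp r) (fun j : {k : int & I k} => l (tagged j)).
Hypothesis hb : forall k (tau : I k), is_block mu p t w (Q tau) (b tau).

(** Summability of the powers leaves countably many nonzero coefficients over all cubes, hence in
    each generation. Measurability of the generation sums rests on this. *)
Lemma countable_coef k : countable [set tau : I k | l tau != 0].
Proof.
have := countable_esum_support (fun j => powR_ge0 _ _) hl.
move=> /countable_injP[f finj]; apply/countable_injP.
exists (fun tau => f (Tagged I tau)) => tau1 tau2.
rewrite !inE => t1 t2 /finj /eqP.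
rewrite eq_Tagged => /(_ _ _)/eqP; apply; rewrite inE /= powR_eq0 cabs_eq0 negb_and.
  by rewrite t1.
by rewrite t2.
Qed.

Lemma cmeasurable_generation k :
  cmeasurable (fun x => \sum_(tau \in [set: I k]) l tau * b tau x).
Proof.
apply: (cmeasurable_fsbig_disjoint (E := fun tau : I k => Q tau) (countable_coef k)).
- by move=> tau; exact: (dyadic_cube_measurable hX hQ).
- by move=> tau beta; exact: (dyadic_cube_disjoint hX hQ).
- move=> tau; have [mb _ _] := hb tau.
  by apply: cmeasurableM => //; exact: cmeasurable_cst.
- by move=> tau x nQ; have [_ -> //] := hb tau; rewrite mulr0.
- by move=> tau x /= /negP /negPn /eqP ->; rewrite mul0r.
Qed.

(* A multiplier that is constant on each generation acts on the blocks
   themselves; the bound [2] is moved into the coefficients. *)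
Lemma block_space_multiplier (m : int -> X -> R[i]) (g : X -> R[i]) :
  (forall k, cmeasurable (m k)) -> (forall k x, cabs (m k x) <= 2) ->
  cmeasurable g ->
  {ae mu, forall x, zsum_to
    (fun k => m k x * \sum_(tau \in [set: I k]) l tau * b tau x) (g x)} ->
  block_space mu Q p t r w g.
Proof.
move=> mm m2 mg gsum; split => //.
exists (fun k tau => 2 * l tau), (fun k tau x => m k x / 2 * b tau x); split.
- rewrite /in_lq; under eq_esum do rewrite cabsM powRM ?cabs_ge0//.
  apply: esumZ_lty => // [j|]; exact: powR_ge0.
- move=> k tau; have [mb _ _] := hb tau.
  apply: is_block_le (hb tau) => //.
  + exact: (dyadic_cube_measurable hX hQ).
  + apply: cmeasurableM => //; apply: cmeasurableM => //.
  + move=> x; rewrite cabsM ler_piMl ?cabs_ge0//.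
    apply: cabs_div_le => //; rewrite mul1r (le_trans (m2 k x))//.
    by rewrite /cabs normr_nat (_ : 2 = 2%:C%C) ?rmorph_nat.
- apply: filterS gsum => x.
  congr zsum_to; apply/funext => k; rewrite mulr_fsumr; apply: eq_fsbigr => tau _.
  by rewrite [RHS]mulrACA [2 * (_ / 2)]mulrC divfK ?pnatr_eq0.
Qed.

End block_space.

Theorem lemma3p8 (R : realType) (d : measure_display) (X : measurableType d)
  (rho : X -> X -> R) (mu : {measure set X -> \bar R})
  (hX : homogeneous_type rho mu) (hmuX : mu [set: X] = +oo%E)
  (kappa0 : R) (I : int -> choiceType) (Q : forall k : int, I k -> set X)
  (hQ : dyadic_system rho mu kappa0 Q) (hQmu : reverse_doubling mu Q)
  (p t r : \bar R) (hp : (1 < p)%E) (hpt : (p <= t)%E) (htr : (t <= r)%E)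
  (w : X -> R) (hw : is_weight rho mu w)
  (hw' : is_weight rho mu (dual_weight p w))
  (f : X -> R[i]) (hf : cmeasurable f) :
  block_space mu Q p t r w f <->
  exists2 g : X -> R[i], block_space mu Q p t r w g &
    {ae mu, forall x, `|f x| <= g x}.
Proof.
have [mw' _ _] := hw'.
have mnf := cmeasurable_norm hf.
split=> [[_ [l [b [hl hb fsum]]]]|[g [mg [l [b [hl hb gsum]]]] fg]].
- exists (fun x => `|f x|); last exact/aeW.
  set u := fun (x : X) (k : int) => \sum_(tau \in [set: I k]) l k tau * b k tau x.
  have mu_ k : cmeasurable (u ^~ k) by exact: (cmeasurable_generation hX hQ hl hb).
  pose S n x := zpartial (u x) n.
  have mS n : cmeasurable (S n).
    by apply: cmeasurableD; apply: cmeasurable_sum => i; exact: mu_.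
  pose P n x := cabs (f x) <= 2 * cabs (S n x).
  have mP n : measurable [set x | P n x].
    rewrite -[X in measurable X]setTI.
    apply: (measurable_fun_ler (measurable_cabs hf) _ measurableT (Y := [set true])) => //.
    by apply: measurable_funM => //; exact: measurable_cabs.
  pose m n k x := if zwindow n k then `|f x| / S n x else 0.
  (* The least admissible [n] makes the choice measurable in [x]; where no [n] is admissible, a null
     set, the multiplier is [0]. *)
  pose m' k x := if pselect (exists n, P n x) is left e then m (ex_minn e) k x else 0.
  (* [E i.+1] is where the least admissible index is [i], and [E 0] is where there is none; on each
     piece [m'] is given by a single formula. *)
  pose E n := if n is i.+1 then [set x | P i x] `\` \bigcup_(j < i) [set x | P j x]
    else ~` \bigcup_i [set x | P i x].
  have EP n x : E n x -> forall k, m' k x = if n is i.+1 then m i k x else 0.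
    rewrite /m'; case: n => [nP|n [Pn nP]] k; case: pselect => [e|ne].
    + by case: nP; have [i Pi] := e; exists i.
    + by [].
    + case: ex_minnP => i Pi imin; congr (m _ k x).
      apply/eqP; rewrite eqn_leq imin// leqNgt; apply/negP => ni.
      by apply: nP; exists i.
    + by case: ne; exists n.
  have cE x : exists n, E n x.
    have [e|ne] := pselect (exists n, P n x); last first.
      by exists 0%N => -[n _ Pn]; apply: ne; exists n.
    case: (ex_minnP e) => n Pn nmin; exists n.+1; split => // -[j /= jn Pj].
    by have := nmin j Pj; rewrite leqNgt jn.
  apply: (block_space_multiplier hX hQ hp mw' hl hb (m := m')) => //.
  + move=> k; apply: (@cmeasurable_cover _ _ _ E
      (fun n x => if n is i.+1 then m i k x else 0)) => //.
    * case=> [|n]; first by apply: measurableC; exact: bigcup_measurable.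
      by apply: measurableD => //; exact: bigcup_measurable.
    * case=> [|n]; first exact: cmeasurable_cst.
      rewrite /m; case: zwindow; last exact: cmeasurable_cst.
      by apply: cmeasurableM => //; exact: cmeasurableV.
    * by move=> n x /EP.
  + move=> k x; have [n Enx] := cE x; rewrite (EP n)//.
    case: n Enx => [|n [Pn _]]; first by rewrite /cabs normr0.
    rewrite /m; case: zwindow; last by rewrite /cabs normr0.
    by apply: cabs_div_le => //; rewrite {1}/cabs normr_id.
  (* Convergence at [x] yields an admissible index, which rules out [E 0]. *)
  + apply: filterS fsum => x /zsum_norm_le2[i fi].
    have Pi : P i x.
      by rewrite /P -lecR rmorphM rmorph_nat -!cabsE.
    have [[nP|n Enx]] := cE x; first by case: nP; exists i.
    have Pn := Enx.1.
    rewrite (_ : (fun k => m' k x * _) = fun k => m n k x * u x k); last first.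
      by apply/funext => k; rewrite (EP n.+1).
    suff -> : `|f x| = `|f x| / S n x * S n x by exact: zsum_window.
    (* If [S n x = 0], then [P n x] forces [f x = 0], so the convention for division by zero gives
       the right value. *)
    have [S0|S0] := eqVneq (S n x) 0; last by rewrite divfK.
    rewrite S0 mulr0; apply/eqP; rewrite normr_eq0 -cabs_eq0 eq_le cabs_ge0 andbT.
    by rewrite (le_trans Pn)// S0 /cabs normr0 mulr0.
(* The test makes the bound on [c] hold everywhere, although [f] is dominated by [g] only almost
   everywhere. The same multiplier serves all generations. *)
- pose c x := if cabs (f x) <= cabs (g x) then f x / g x else 0.
  apply: (block_space_multiplier hX hQ hp mw' hl hb (m := fun _ => c)) => //.
  + move=> _; apply: cmeasurable_if; last exact: cmeasurable_cst.
      by apply: measurable_fun_ler; exact: measurable_cabs.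
    by apply: cmeasurableM => //; exact: cmeasurableV.
  + move=> _ x; rewrite /c; case: ifP => [fgx|_]; last by rewrite /cabs normr0.
    by apply: (@le_trans _ _ 1); [apply: cabs_div_le; rewrite ?mul1r|rewrite ler1n].
  + apply: filterS2 fg gsum => x fgx /zsumZ; move/(_ (c x)).
    (* In the order of [R[i]], [0 <= |f x| <= g x] makes [g x] a nonnegative real, equal to its own
       norm. *)
    have fgx' : cabs (f x) <= cabs (g x).
      by rewrite ler_cabs (le_trans fgx)// ger0_norm// (le_trans _ fgx).
    suff -> : c x * g x = f x by [].
    (* Where [g x = 0], domination gives [f x = 0], so dividing by zero does no harm. *)
    rewrite /c fgx'; have [g0|g0] := eqVneq (g x) 0; last by rewrite divfK.
    rewrite g0 mulr0; apply/esym/eqP; rewrite -cabs_eq0 eq_le cabs_ge0 andbT.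
    by rewrite (le_trans fgx')// g0 /cabs normr0.
Qed.
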